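(* Suppose each control function $f_i$ ($i\in\mathcal N=\{1,\dots,n\}$) is non-increasing on $\mathbb R$ and strictly decreasing and differentiable on $(-\infty,-\delta_i/2)\cup(\delta_i/2,+\infty)$. Consider the dynamical system $\mathcal D_1$: $$v(t)=Xq(t)+\tilde v,\qquad q_i(t+1)=\big[f_i\big(v_i(t)-v_i^{\mathrm{nom}}\big)\big]_{\Omega_i},\quad i\in\mathcal N,$$ and the optimization problem $$\min_{q\in\Omega}\ F(q),\qquad F(q)=\sum_{i\in\mathcal N}C_i(q_i)+\tfrac12 q^\top Xq+q^\top(\tilde v-v^{\mathrm{nom}}).$$ Then $\mathcal D_1$ has a unique equilibrium point. Moreover, a point $(v^*,q^* )$ is an equilibrium of $\mathcal D_1$ if and only if $q^*$ is the unique optimal solution of $\min_{q\in\Omega}F(q)$ and $v^*=Xq^*+\tilde v$.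
   Context: Network: a tree with vertex set $\{0,1,\dots,n\}$ and edge set $\mathcal L$; each line $(h,k)\in\mathcal L$ has reactance $x_{hk}>0$. $\mathcal L_i\subseteq\mathcal L$ is the set of lines on the unique path from bus $0$ to bus $i$, and $X\in\mathbb R^{n\times n}$ is given by $X_{ij}=\sum_{(h,k)\in\mathcal L_i\cap\mathcal L_j}x_{hk}$ (a symmetric positive definite matrix). $\tilde v\in\mathbb R^n$ is a constant vector and $v^{\mathrm{nom}}=(1,\dots,1)^\top$. Feasible sets: $\Omega=\prod_{i=1}^n\Omega_i$, $\Omega_i=\{q_i: q_i^{\min}\le q_i\le q_i^{\max}\}$. For a bus with a controllable inverter, $q_i^{\max}=\min\{p_i\tan\rho_i,\sqrt{s_i^2-p_i^2}\}$ and $q_i^{\min}=\max\{-p_i\tan\rho_i,-\sqrt{s_i^2-p_i^2}\}$, with constants $0\le p_i\le s_i$, $0\le\rho_i\le\pi/2$ (if $\rho_i=\pi/2$ the $\tan$ term is omitted); for a bus without one, $\Omega_i$ is a singleton. $[\cdot]_{\Omega_i}$ is the projection onto $\Omega_i$, and $[\cdot]_\Omega$ acts componentwise. Control functions: $f_i:\mathbb R\to\mathbb R$ has a deadband $[-\delta_i/2,\delta_i/2]$, $\delta_i\ge0$, on which the control is zero. $f(v)=(f_1(v_1),\dots,f_n(v_n))$. Inverse and cost: $f_i^{-1}$ denotes the (generalized) inverse of the non-increasing function $f_i$: $f_i^{-1}(0):=0$, and for $q\ne0$, $f_i^{-1}(q)=\sup\{v: f_i(v)\ge q\}$, which is the unique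 point where $f_i$ takes the value $q$ whenever that value is attained. The cost is $C_i(q_i):=-\int_0^{q_i}f_i^{-1}(q)\,dq$. Equilibrium: $(v^*,q^* )$ is an equilibrium point of $\mathcal D_1$ if $v^*=Xq^*+\tilde v$ and $q^*=[f(v^*-v^{\mathrm{nom}})]_\Omega$.
   Formalization: Each control function is also assumed continuous (including at the deadband endpoints), and the cost C_i is assumed finite at the fixed value of every bus without a controllable inverter; the claim fails without these. *)

(* Defs.v *)
From HB Require Import structures.
From mathcomp Require Import all_boot all_order all_algebra.
From mathcomp Require Import all_classical all_reals all_analysis.
Set Implicit Arguments.
Unset Strict Implicit.
Unset Printing Implicit Defensive.
Import Order.TTheory GRing.Theory Num.Theory.
Import numFieldNormedType.Exports.
Local Open Scope ring_scope.

(* Lines are unordered pairs [set h; k] of buses, so a network on the buses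
   0, ..., n is a set of 2-element sets. *)
Definition line_rel n (L : {set {set 'I_n.+1}}) : rel 'I_n.+1 :=
  fun h k => (h != k) && ([set h; k]%SET \in L).

Definition is_tree n (L : {set {set 'I_n.+1}}) : Prop :=
  [/\ forall l, l \in L -> #|l| = 2%N,
      forall h k, connect (line_rel L) h k
    & forall c, (2 < size c)%N -> ~ ucycle (line_rel L) c].

Definition simple_path_from_root n (L : {set {set 'I_n.+1}}) (k : 'I_n.+1)
    (p : seq 'I_n.+1) : Prop :=
  [/\ path (line_rel L) ord0 p, uniq (ord0 :: p) & last ord0 p = k].

Definition path_lines n (p : seq 'I_n.+1) : seq {set 'I_n.+1} :=
  pairmap (fun h k => [set h; k]%SET) ord0 p.

(* In a tree the simple path p below is unique. *)
Definition lines_to n (L : {set {set 'I_n.+1}}) (k : 'I_n.+1) :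
    {set {set 'I_n.+1}} :=
  [set l in L | `[< exists p, simple_path_from_root L k p
                              /\ l \in path_lines p >]]%SET.

(* The index i : 'I_n stands for the bus i + 1, which is lift ord0 i among
   the buses 0, ..., n. *)
Definition reactance_matrix (R : realType) n (L : {set {set 'I_n.+1}})
    (x : {set 'I_n.+1} -> R) : 'M[R]_n :=
  \matrix_(i, j)
    \sum_(l in (lines_to L (lift ord0 i) :&: lines_to L (lift ord0 j))%SET) x l.

Local Open Scope classical_set_scope.

(* The case split matters: the library's tan (pi / 2) is a junk value. *)
Definition qmax (R : realType) (p s rho : R) : R :=
  if rho == pi / 2 then Num.sqrt (s ^+ 2 - p ^+ 2)
  else Num.min (p * tan rho) (Num.sqrt (s ^+ 2 - p ^+ 2)).

Definition qmin (R : realType) (p s rho : R) : R :=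
  if rho == pi / 2 then - Num.sqrt (s ^+ 2 - p ^+ 2)
  else Num.max (- (p * tan rho)) (- Num.sqrt (s ^+ 2 - p ^+ 2)).

(* qfix i is the only admissible value at a bus i without controllable
   inverter; p, s, rho are irrelevant there, and qfix is irrelevant at the
   other buses. *)
Definition bus_set (R : realType) n (inverter : pred 'I_n)
    (p s rho qfix : 'I_n -> R) (i : 'I_n) : set R :=
  if inverter i then
    [set y | qmin (p i) (s i) (rho i) <= y <= qmax (p i) (s i) (rho i)]
  else [set qfix i].

Definition box (R : realType) n (Omega : 'I_n -> set R) : set 'cV[R]_n :=
  [set q | forall i, Omega i (q i 0)].

Definition proj (R : realType) (A : set R) (y : R) : R :=
  get [set z | A z /\ forall w, A w -> `|y - z| <= `|y - w|].

Definition proj_box (R : realType) n (Omega : 'I_n -> set R)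
    (y : 'cV[R]_n) : 'cV[R]_n := \col_i proj (Omega i) (y i 0).

Definition control (R : realType) n (f : 'I_n -> R -> R)
    (v : 'cV[R]_n) : 'cV[R]_n := \col_i f i (v i 0).

Definition v_nom (R : realType) n : 'cV[R]_n := const_mx 1.

Definition voltage (R : realType) n (X : 'M[R]_n) (vt q : 'cV[R]_n) :
  'cV[R]_n := X *m q + vt.

Definition injection (R : realType) n (Omega : 'I_n -> set R)
    (f : 'I_n -> R -> R) (v : 'cV[R]_n) : 'cV[R]_n :=
  proj_box Omega (control f (v - v_nom R n)).

(* The dynamics is v t = voltage X vt (q t), q t.+1 = injection Omega f (v t);
   an equilibrium is a constant trajectory. *)
Definition equilibrium (R : realType) n (X : 'M[R]_n) (vt : 'cV[R]_n)
    (Omega : 'I_n -> set R) (f : 'I_n -> R -> R) (v q : 'cV[R]_n) : Prop :=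
  v = voltage X vt q /\ q = injection Omega f v.

(* The value is +oo for q below the range of f and -oo for q above it. *)
Definition gen_inv (R : realType) (f : R -> R) (q : R) : \bar R :=
  if q == 0 then 0%E else ereal_sup [set v%:E | v in [set v | q <= f v]].

(* The two branches are minus the oriented integral from 0 to q. For a control
   function vanishing at 0 the integrand has the sign opposite to that of its
   argument, so the cost lies in [0, +oo]; it is +oo outside the closure of the
   range of f. *)
Definition cost (R : realType) (f : R -> R) (q : R) : \bar R :=
  if 0 <= q then (- \int[lebesgue_measure]_(y in `[0%R, q]) gen_inv f y)%E
  else (\int[lebesgue_measure]_(y in `[q, 0%R]) gen_inv f y)%E.

Definition objective (R : realType) n (X : 'M[R]_n) (vt : 'cV[R]_n)
    (f : 'I_n -> R -> R) (q : 'cV[R]_n) : \bar R :=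
  (\sum_(i < n) cost (f i) (q i 0)%R
   + (2^-1 * (q^T *m X *m q) 0 0 + (q^T *m (vt - v_nom R n)) 0 0)%R%:E)%E.

Definition minimizer (R : realType) n (A : set 'cV[R]_n)
    (F : 'cV[R]_n -> \bar R) (q : 'cV[R]_n) : Prop :=
  A q /\ forall q', A q' -> (F q <= F q')%E.

(* Main.v *)
Require Import Defs.
From HB Require Import structures.
From mathcomp Require Import all_boot all_order all_algebra.
From mathcomp Require Import all_classical all_reals all_analysis.
From mathcomp Require Import measurable_realfun ring lra.
Import Order.TTheory GRing.Theory Num.Theory.
Import numFieldNormedType.Exports.
Local Open Scope ring_scope.
Local Open Scope classical_set_scope.
Set Implicit Arguments.
Unset Strict Implicit.
Unset Printing Implicit Defensive.

(* X is positive definite: if k is a deepest bus with q_k != 0 and l is the last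
   line on the path to k, every other bus using l lies below k, so the sum of
   the q_i over the buses using l is q_k, and q' X q is the sum over the lines
   of x_l times the squares of these sums.

   An equilibrium is a solution of q = g (X q + c), where g_i is f_i followed by
   the projection on Omega_i and c = v~ - v_nom; it is obtained by minimising a
   potential over the box. At an equilibrium, with w = X q + c, the projection
   makes - w_i a subgradient of C_i on Omega_i at q_i, whence
     F q + 1/2 (q' - q)' X (q' - q) <= F q'   for every q' in the box,
   with F q finite. So the q of any equilibrium is the unique minimiser, and
   both uniqueness and the equivalence follow from existence. *)

Lemma lebesgue_measure_bnd (R : realType) (a b : R) (x y : bool) : a <= b ->
  lebesgue_measure [set` Interval (BSide x a) (BSide y b)] = (b - a)%:E.
Proof.
move=> ab; rewrite lebesgue_measure_itv/= lte_fin; case: ltP => [//|ba].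
by rewrite (le_anti (_ : a <= b <= a)) ?ab// subrr.
Qed.

(** * Simple paths and last lines in a tree *)

Lemma line_rel_sym {n} (L : {set {set 'I_n.+1}}) : symmetric (line_rel L).
Proof. by move=> h k; rewrite /line_rel eq_sym finset.setUC. Qed.

(* If the two paths leave a through different neighbours d and d', following
   one and then the other backwards connects d to d' without a, and closing
   up through a gives a cycle. *)
Lemma tree_same_step {n} (L : {set {set 'I_n.+1}}) a d d' p p' :
  is_tree L ->
  path (line_rel L) a (d :: p) -> uniq (a :: d :: p) ->
  path (line_rel L) a (d' :: p') -> uniq (a :: d' :: p') ->
  last d p = last d' p' -> d = d'.
Proof.
case=> _ _ acyclic Pp Up Pp' Up' eq_last; apply/eqP/negP => /negP neq_dd'.
pose e := [rel h k | [&& line_rel L h k, h != a & k != a]].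
have sym_e : connect_sym e.
  by apply: sym_connect_sym => h k /=; rewrite line_rel_sym (andbC (h != a)).
have avoid h s : path (line_rel L) h s -> a \notin h :: s ->
    connect e h (last h s).
  elim: s h => [|k s IHs] h //= /andP[hk Ps] /[!inE] /norP[ah /norP[ak as_]].
  apply: (connect_trans (y := k)); last first.
    by apply: IHs => //; rewrite inE negb_or ak.
  by apply: connect1; rewrite /= hk eq_sym ah eq_sym ak.
have dd' : connect e d d'.
  move: Pp Up Pp' Up' => /= /andP[_ Pp] /andP[ap _] /andP[_ Pp'] /andP[ap' _].
  apply: (connect_trans (y := last d p)); first exact: avoid.
  by rewrite eq_last sym_e; exact: avoid.
case/connectP: dd' => s /shortenP[s' es' us' _] last_s'.
have a_s' : a \notin d :: s'.
  have da : d != a.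
    by move: Up => /=; rewrite inE negb_or eq_sym => /andP[/andP[]].
  rewrite inE negb_or eq_sym da /=.
  elim: (s') (d) es' {us' last_s'} => [|k t IHt] h //=.
  by case/andP=> /and3P[_ _ ka] /IHt at'; rewrite inE negb_or eq_sym ka.
(* The cycle has more than two vertices: as [d] differs from [d'], the path [s'] is nonempty. *)
apply: (acyclic (a :: d :: s')).
  by case: s' last_s' {es' us' a_s'} => [/eqP|//]; rewrite eq_sym (negbTE neq_dd').
apply/andP; split; last by rewrite cons_uniq a_s' us'.
rewrite /= rcons_path -last_s'.
move: Pp Pp' => /= /andP[-> _] /andP[ad' _]; rewrite line_rel_sym ad' andbT /=.
by apply: sub_path es' => h k /and3P[].
Qed.

(** Induction along the paths: [tree_same_step] makes the first steps agree. If only one path is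
    empty, the other returns to [a], which [uniq] forbids. *)
Lemma tree_path_unique {n} (L : {set {set 'I_n.+1}}) a p p' :
  is_tree L ->
  path (line_rel L) a p -> uniq (a :: p) ->
  path (line_rel L) a p' -> uniq (a :: p') ->
  last a p = last a p' -> p = p'.
Proof.
move=> Ltree; elim: p a p' => [|d p IHp] a [|d' p'] //.
- by move=> _ _ _ /= /andP[ap' _] al; rewrite al mem_last in ap'.
- by move=> _ /= /andP[ap _] _ _ al; rewrite -al mem_last in ap.
move=> Pp Up Pp' Up' eq_last.
have dd' := tree_same_step Ltree Pp Up Pp' Up' eq_last.
rewrite -dd' in Pp' Up' eq_last *; congr (_ :: _); apply: (IHp d).
- by move: Pp => /= /andP[].
- by move: Up => /= /andP[].
- by move: Pp' => /= /andP[].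
- by move: Up' => /= /andP[].
- exact: eq_last.
Qed.

Lemma tree_path_exists {n} (L : {set {set 'I_n.+1}}) k :
  is_tree L -> exists p, simple_path_from_root L k p.
Proof.
case=> _ conn _; have /connectP[p /shortenP[p' Pp' Up' _] ->] := conn ord0 k.
by exists p'.
Qed.

Lemma mem_path_lines {n} (h : 'I_n.+1) p l :
  l \in path_lines p -> h \in l -> h != ord0 -> h \in p.
Proof.
rewrite /path_lines => lp hl h0.
suff : h \in ord0 :: p by rewrite inE (negbTE h0).
move: (ord0) lp; elim: p {h0} => [|b p IHp] a //=.
rewrite inE => /predU1P[l_ab|/IHp]; last by rewrite !inE => ->; rewrite orbT.
by move: hl; rewrite l_ab !inE => /orP[]->; rewrite ?orbT.
Qed.

(** The part of [p'] up to [h] is a simple path to [h], hence it is [p] by uniqueness. Either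
    something follows it in [p'], or [p'] ends at [h]. *)
Lemma tree_path_prefix {n} (L : {set {set 'I_n.+1}}) h k p p' :
  is_tree L -> simple_path_from_root L h p -> simple_path_from_root L k p' ->
  h \in p' -> (size p < size p')%N \/ h = k.
Proof.
move=> Ltree [Pp Up lp] [Pp' Up' lp'] hp'.
case/path.splitP: hp' Pp' Up' lp' => p1 p2 Pp' Up' lp'.
have p_p1 : p = rcons p1 h.
  apply: (@tree_path_unique _ L ord0) => //.
  - by move: Pp'; rewrite cat_path => /andP[].
  - by move: Up'; rewrite -cat_cons cat_uniq => /andP[].
  - by rewrite last_rcons.
case: p2 {Pp' Up'} lp' => [|b p2] lp'; last first.
  by left; rewrite p_p1 size_cat /= -[X in (X < _)%N]addn0 ltn_add2l.
by right; rewrite -lp' cats0 last_rcons.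
Qed.

Lemma lines_toP {n} (L : {set {set 'I_n.+1}}) k p l :
  is_tree L -> simple_path_from_root L k p ->
  (l \in lines_to L k) = (l \in L) && (l \in path_lines p).
Proof.
move=> Ltree [Pp Up lp]; rewrite inE; congr (_ && _).
apply/asboolP/idP => [[p' [[Pp' Up' lp'] lp'l]]|lpl]; last by exists p.
suff -> : p = p' by [].
by apply: (@tree_path_unique _ L ord0) => //; rewrite lp lp'.
Qed.

(* l is the last line of the path to k: every other bus whose path uses l lies
   strictly below k. *)
Lemma tree_last_line {n} (L : {set {set 'I_n.+1}}) k p :
  is_tree L -> simple_path_from_root L k p -> k != ord0 ->
  exists2 l, l \in lines_to L k &
    forall h p', simple_path_from_root L h p' -> l \in lines_to L h ->
      (size p < size p')%N \/ h = k.
Proof.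
move=> Ltree; case/lastP: p => [|p b] Pk; first by case: Pk => _ _ /= <-; rewrite eqxx.
have [Pp Up lp] := Pk; rewrite last_rcons in lp; subst b => k0.
pose l := [set last ord0 p; k]%SET.
have lL : l \in L by move: Pp; rewrite rcons_path /line_rel => /and3P[].
exists l.
  rewrite (lines_toP _ Ltree Pk) lL /path_lines /=.
  by elim: p (ord0) {lL Pp Up k0 Pk} @l => [|b p IHp] a l /=; rewrite !inE ?eqxx ?IHp ?orbT.
(* As [k] is an end of [l] other than the root, a path using [l] visits [k], so the path to [k] is a
   prefix of it. *)
move=> h p' Ph lh; rewrite (lines_toP _ Ltree Ph) lL /= in lh.
have kl : k \in l by rewrite !inE eqxx orbT.
have kp' : k \in p' := mem_path_lines lh kl k0.
by case: (tree_path_prefix Ltree Pk Ph kp') => [|->]; [left|right].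
Qed.

(** * Symmetry and positive definiteness of the reactance matrix *)

Lemma reactance_matrix_sym (R : realType) n (L : {set {set 'I_n.+1}})
    (x : {set 'I_n.+1} -> R) :
  (reactance_matrix L x)^T = reactance_matrix L x.
Proof. by apply/matrixP => i j; rewrite !mxE finset.setIC. Qed.

(** A line [l] enters the entry (i, j) exactly when both paths use it. Summing over lines first
    therefore turns the double sum over buses into a square for each line. *)
Lemma reactance_formE (R : realType) n (L : {set {set 'I_n.+1}})
    (x : {set 'I_n.+1} -> R) (q : 'cV[R]_n) :
  (q^T *m reactance_matrix L x *m q) 0 0 =
  \sum_(l in L) x l * (\sum_(i | l \in lines_to L (lift ord0 i)) q i 0) ^+ 2.
Proof.
have in_lines k l : l \in lines_to L k -> l \in L by rewrite inE => /andP[].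
rewrite mxE; under eq_bigr => j _ do rewrite mxE mulr_suml.
under eq_bigr => j _ do under eq_bigr => i _ do
  rewrite !mxE mulr_sumr mulr_suml (big_mkcond (fun l => l \in _)) /=.
under eq_bigr => j _ do rewrite exchange_big /=.
rewrite exchange_big /= [RHS]big_mkcond /=; apply: eq_bigr => l _.
have [lL|lNL] := ifPn (l \in L); last first.
  apply: big1 => j _; apply: big1 => i _; rewrite inE.
  by case: ifP => // /andP[/in_lines lL]; rewrite lL in lNL.
rewrite expr2 mulr_sumr mulr_sumr [RHS]big_mkcond; apply: eq_bigr => j _.
case: ifP => lj; last by apply: big1 => i _; rewrite inE lj andbF.
rewrite mulr_suml mulr_sumr [RHS]big_mkcond; apply: eq_bigr => i _.
by rewrite inE lj andbT; case: ifP => // _; rewrite mulrCA mulrA.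
Qed.

Lemma reactance_matrix_posdef (R : realType) n (L : {set {set 'I_n.+1}})
    (x : {set 'I_n.+1} -> R) (q : 'cV[R]_n) :
  is_tree L -> (forall l, l \in L -> 0 < x l) -> q != 0 ->
  0 < (q^T *m reactance_matrix L x *m q) 0 0.
Proof.
move=> Ltree x_gt0 q0; rewrite reactance_formE lt_def sumr_ge0 ?andbT; last first.
  by move=> l /x_gt0/ltW xl; rewrite mulr_ge0// sqr_ge0.
apply/negP => /eqP /psumr_eq0P form0.
have {form0} line0 l : l \in L ->
    \sum_(i | l \in lines_to L (lift ord0 i)) q i 0 = 0.
  move=> lL; have /eqP : x l * (\sum_(i | l \in lines_to L (lift ord0 i)) q i 0) ^+ 2 = 0.
    by apply: form0 => // k /x_gt0/ltW xk; rewrite mulr_ge0// sqr_ge0.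
  by rewrite mulf_eq0 gt_eqF ?x_gt0//= sqrf_eq0 => /eqP.
have [i qi0] : exists i, q i 0 != 0.
  apply/existsP; apply: contraNT q0 => /existsPn q0; apply/eqP/matrixP => i j.
  by rewrite ord1 mxE; apply/eqP/negPn/q0.
have /choice[path_of path_ofP] : forall k, exists p, simple_path_from_root L k p.
  by move=> k; exact: tree_path_exists.
(* [k] is a deepest bus with nonzero [q]. The buses strictly below it have zero [q], so the
   vanishing sum for its last line reduces to [q k 0]. *)
have [k qk0 kmax] := @arg_maxnP _ i (fun i => q i 0 != 0)
  (fun i => size (path_of (lift ord0 i))) qi0.
have [|l lk below] :=
  tree_last_line Ltree (path_ofP (lift ord0 k)).
  by rewrite eq_sym neq_lift.
have lL : l \in L by move: lk; rewrite inE => /andP[].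
move: (line0 l lL); rewrite (bigD1 k)//= big1 ?addr0; first exact/eqP.
move=> j /andP[lj jk]; apply/eqP/negPn/negP => qj0.
case: (below _ _ (path_ofP _) lj) => [|/lift_inj /eqP]; last by rewrite (negbTE jk).
by rewrite ltnNge; have := kmax j qj0; rewrite /= => ->.
Qed.

(** * Existence of a fixed point by minimising a potential *)

Definition quad_form (R : realType) n (X : 'M[R]_n) (u : 'cV[R]_n) : R :=
  (u^T *m X *m u) 0 0.

Lemma quad_formD (R : realType) n (X : 'M[R]_n) (u d : 'cV[R]_n) :
  X^T = X ->
  quad_form X (u + d) =
  quad_form X u + 2 * \sum_i d i 0 * (X *m u) i 0 + quad_form X d.
Proof.
move=> Xsym; rewrite /quad_form.
have -> : \sum_i d i 0 * (X *m u) i 0 = (d^T *m X *m u) 0 0.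
  by rewrite -mulmxA [RHS]mxE; apply: eq_bigr => i _; rewrite [d^T _ _]mxE.
have udE : (u^T *m X *m d) 0 0 = (d^T *m X *m u) 0 0.
  by rewrite -[in LHS](trmxK (u^T *m X *m d)) mxE !trmx_mul trmxK Xsym mulmxA.
have addE (A B : 'M[R]_1) : (A + B) 0 0 = A 0 0 + B 0 0 by rewrite mxE.
have trD : (u + d)^T = u^T + d^T by exact: linearD.
rewrite mulmxDr trD !mulmxDl !addE udE; ring.
Qed.

(* H is minus a primitive of g; the inequality is its convexity. *)
Lemma monotone_potential (R : realType) (g : R -> R) (lo hi m : R) :
  continuous g -> (forall v w, v <= w -> g w <= g v) ->
  (forall v, lo <= g v <= hi) ->
  exists H : R -> R, continuous H /\
    forall a b, m <= a -> m <= b -> H a - H b <= g a * (b - a).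
Proof.
move=> cg gni gb.
pose mu := @lebesgue_measure R.
(* For [x] below [m] the domain is empty and [H] is constant, so [H] is minus a primitive of [g]
   only to the right of [m]. *)
pose H x := - (\int[mu]_(y in `[m, x]) g y)%R.
have intg a b : mu.-integrable `[a, b]%classic (EFin \o g).
  by apply: continuous_compact_integrable; [exact: segment_compact|exact: continuous_subspaceT].
have intg' a b : mu.-integrable `]a, b]%classic (EFin \o g).
  by apply: integrableS (intg a b) => //; exact: subset_itv_oc_cc.
have bounds a b : m <= a -> a <= b ->
    g b * (b - a) <= H a - H b <= g a * (b - a).
  move=> ma ab.
  have -> : H a - H b =
      (\int[mu]_(y in `[m, b]) g y - \int[mu]_(y in `[m, a]) g y)%R.
    by rewrite /H opprK addrC.
  rewrite (Rintegral_itvB (intg m b)) ?bnd_simp//.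
  have icst c : mu.-integrable `]a, b]%classic (EFin \o cst c).
    apply: integrableS (continuous_compact_integrable (@segment_compact R a b) _) => //.
      exact: subset_itv_oc_cc.
    exact/continuous_subspaceT/cst_continuous.
  have vol c : c * (b - a) = (\int[mu]_(y in `]a, b]) c)%R.
    rewrite Rintegral_cst//; congr (_ * _).
    by have /(congr1 fine) /= -> := lebesgue_measure_bnd false false ab.
  rewrite !vol; apply/andP; split; apply: le_Rintegral => //; try exact: icst.
    by move=> y /=; rewrite in_itv/= => /andP[_ yb]; exact: gni.
  by move=> y /=; rewrite in_itv/= => /andP[/ltW ay _]; exact: gni.
exists H; split; last first.
  move=> a b ma mb; case/orP: (le_total a b) => ab.
    by have /andP[] := bounds a b ma ab.
  rewrite -lerN2 opprB -mulrN opprB.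
  by have /andP[] := bounds b a mb ab.
(* [K] bounds the absolute value of [g] and is a Lipschitz constant of [H]; the summand 1 makes it
   positive, so that [e / K] makes sense. *)
pose K := `|lo| + `|hi| + 1.
have gK v : `|g v| <= K.
  have /andP[glo ghi] := gb v; rewrite /K ler_norml; apply/andP; split.
    have := ler_norm (- lo); rewrite normrN; have := normr_ge0 hi; lra.
  have := ler_norm hi; have := normr_ge0 lo; lra.
have K0 : 0 < K by rewrite /K; have := normr_ge0 hi; have := normr_ge0 lo; lra.
have lip_m a b : m <= a -> a <= b -> `|H a - H b| <= K * (b - a).
  move=> ma ab; have /andP[l r] := bounds a b ma ab.
  have ba : 0 <= b - a by rewrite subr_ge0.
  rewrite ler_norml; apply/andP; split.
    apply: le_trans l; rewrite -mulNr ler_wpM2r//.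
    by have := gK b; rewrite ler_norml => /andP[].
  apply: (le_trans r); rewrite ler_wpM2r//.
  by have := gK a; rewrite ler_norml => /andP[].
have H_left a : a <= m -> H a = H m.
  move=> am; rewrite /H; congr (- _); rewrite set_itv1 Rintegral_set1.
  move: am; rewrite le_eqVlt => /predU1P[->|am].
    by rewrite set_itv1 Rintegral_set1.
  by rewrite set_itv_ge ?Rintegral_set0// bnd_simp -ltNge.
have lip a b : a <= b -> `|H a - H b| <= K * (b - a).
  move=> ab; have ba : 0 <= b - a by rewrite subr_ge0.
  have [ma|/ltW am] := leP m a; first exact: lip_m.
  rewrite (H_left a am); have [mb|/ltW bm] := leP m b.
    by apply: (le_trans (lip_m _ _ (lexx m) mb)); rewrite ler_pM2l// lerD2l lerN2.
  by rewrite (H_left b bm) subrr normr0 mulr_ge0// ltW.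
move=> a; apply/cvgrPdist_lt => e e0.
near=> b.
have ab_lt : `|a - b| < e / K.
  by near: b; apply: cvgr_dist_lt; [exact: cvg_id|exact: divr_gt0].
have : `|H a - H b| <= K * `|a - b|.
  case/orP: (le_total a b) => ab.
    by rewrite (distrC a b) (ger0_norm (x := b - a)) ?subr_ge0// lip.
  by rewrite distrC (ger0_norm (x := a - b)) ?subr_ge0// lip.
move/le_lt_trans; apply.
by rewrite mulrC -ltr_pdivlMr.
Unshelve. all: by end_near. Qed.

(* q is the minimiser u over the box of
     1/2 u' X u + sum_i H_i ((X u + c)_i),   H_i' = - g_i,
   whose gradient is X (u - g (X u + c)). As g (X u + c) lies in the box, the
   slope of the potential in the direction d = g (X u + c) - u is nonnegative;
   it equals - d' X d. *)
Lemma monotone_fixed_point (R : realType) n (X : 'M[R]_n) (c : 'cV[R]_n)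
    (g : 'I_n -> R -> R) (lo hi : 'I_n -> R) :
  X^T = X -> (forall u, u != 0 -> 0 < quad_form X u) ->
  (forall i, continuous (g i)) -> (forall i v w, v <= w -> g i w <= g i v) ->
  (forall i v, lo i <= g i v <= hi i) ->
  exists q : 'cV[R]_n, q = \col_i g i ((X *m q + c) i 0).
Proof.
move=> Xsym Xpos cg gni gb.
(* A lower bound of the i-th coordinate of X u + c over the box, so that [H i] is only compared
   where its convexity inequality holds. *)
pose m i := c i 0 - \sum_j `|X i j| * (`|lo j| + `|hi j|).
have mP (u : 'cV[R]_n) i : (forall j, lo j <= u j 0 <= hi j) ->
    m i <= (X *m u + c) i 0.
  move=> ub; rewrite /m mxE [leLHS]addrC lerD2r mxE -sumrN; apply: ler_sum => j _.
  rewrite lerNl; apply: (le_trans (ler_norm _)); rewrite normrN normrM.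
  apply: ler_wpM2l => //; rewrite ler_norml.
  have /andP[lu uh] := ub j; have := ler_norm (hi j); have := ler_norm (- lo j).
  rewrite normrN; have := normr_ge0 (lo j); have := normr_ge0 (hi j).
  by move=> *; apply/andP; split; lra.
have /choice[H HP] : forall i, exists H : R -> R, continuous H /\
    forall a b, m i <= a -> m i <= b -> H a - H b <= g i a * (b - a).
  by move=> i; exact: (monotone_potential (m i) (cg i) (gni i) (gb i)).
pose Phi (u : 'cV[R]_n) :=
  2^-1 * quad_form X u + \sum_i H i ((X *m u + c) i 0).
pose A := [set r : 'rV[R]_n | forall i, `[lo i, hi i]%classic (r ord0 i)].
have Acompact : compact A.
  exact: (rV_compact (fun i => @segment_compact R (lo i) (hi i))).
have A0 : A !=set0.
  by exists (\row_i g i 0) => i /=; rewrite mxE in_itv/= gb.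
have addc (T : topologicalType) (a b : T -> R) : continuous a ->
    continuous b -> continuous (fun r => a r + b r).
  by move=> ca cb r; apply: cvgD; [exact: ca|exact: cb].
have mulc (T : topologicalType) (a b : T -> R) : continuous a ->
    continuous b -> continuous (fun r => a r * b r).
  by move=> ca cb r; apply: cvgM; [exact: ca|exact: cb].
have sum_cont (T : topologicalType) (F : 'I_n -> T -> R) :
    (forall i, continuous (F i)) -> continuous (fun r => \sum_i F i r).
  move=> F_cont r.
  apply: (cvg_big _ (nbhs_filter r)); first exact: add_continuous.
  by move=> i _; exact: F_cont.
have Xu_cont i : continuous (fun r : 'rV[R]_n => (X *m r^T) i 0).
  have -> : (fun r : 'rV[R]_n => (X *m r^T) i 0) =
      fun r => \sum_j X i j * r 0 j.
    by apply/funext => r; rewrite mxE; apply: eq_bigr => j _; rewrite mxE.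
  by apply: (sum_cont) => j; apply: (mulc); [exact: cst_continuous|exact: coord_continuous].
have Phi_cont : continuous (fun r : 'rV[R]_n => Phi r^T).
  have -> : (fun r : 'rV[R]_n => Phi r^T) = fun r =>
      2^-1 * (\sum_j r 0 j * (X *m r^T) j 0) + \sum_i H i ((X *m r^T) i 0 + c i 0).
    apply/funext => r; rewrite /Phi /quad_form -mulmxA mxE trmxK.
    by congr (_ + _); apply: eq_bigr => i _; rewrite mxE.
  apply: (addc).
    apply: (mulc); first exact: cst_continuous.
    by apply: (sum_cont) => j; apply: (mulc); [exact: coord_continuous|exact: Xu_cont].
  apply: (sum_cont) => i r.
  apply: (@continuous_comp _ _ _ (fun r : 'rV[R]_n => (X *m r^T) i 0 + c i 0) (H i)).
    by apply: (addc); [exact: Xu_cont|exact: cst_continuous].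
  exact: (HP i).1.
have [r] := EVT_min_rV A0 Acompact (continuous_subspaceT Phi_cont).
rewrite inE => Ar rmin.
pose u := r^T.
have ub j : lo j <= u j 0 <= hi j by have := Ar j; rewrite /= in_itv/= mxE.
have umin (u' : 'cV[R]_n) : (forall j, lo j <= u' j 0 <= hi j) -> Phi u <= Phi u'.
  move=> u'b; rewrite -[u']trmxK; apply: rmin; rewrite inE => j /=.
  by rewrite in_itv/= mxE u'b.
pose w := X *m u + c.
pose d : 'cV[R]_n := \col_i g i (w i 0) - u.
pose e := X *m d.
suff d0 : d = 0 by exists u; apply/esym/subr0_eq.
apply/eqP/negPn/negP => /Xpos Qd_gt0.
(* Minimality of [u] against u + t d, divided by [t], bounds d' X d by [phi t]: convexity of the
   [H i] bounds their increments, and the first-order terms combine through d' X d = sum of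
   (g_i(w_i) - u_i) e_i. Since [phi] tends to 0 at 0, this contradicts d' X d > 0. *)
pose phi (t : R) := t / 2 * quad_form X d +
  \sum_i (g i (w i 0) - g i (w i 0 + t * e i 0)) * e i 0.
have dE i : d i 0 = g i (w i 0) - u i 0.
  by rewrite mxE [(\col_j _) _ _]mxE [(- u) _ _]mxE.
have slope t : 0 < t <= 1 -> quad_form X d <= phi t.
  move=> /andP[t0 t1].
  have utd j : lo j <= (u + t *: d) j 0 <= hi j.
    have /andP[lg gh] := gb j (w j 0); have /andP[lu uh] := ub j.
    rewrite mxE [(t *: d) _ _]mxE dE; apply/andP; split; nra.
  have wtd i : (X *m (u + t *: d) + c) i 0 = w i 0 + t * e i 0.
    by rewrite mulmxDr -scalemxAr addrAC [LHS]mxE [(t *: e) _ _]mxE.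
  have de : quad_form X d = \sum_i d i 0 * e i 0.
    by rewrite /quad_form -mulmxA mxE; apply: eq_bigr => i _; rewrite [d^T _ _]mxE.
  have dXu : \sum_i d i 0 * (X *m u) i 0 = \sum_i e i 0 * u i 0.
    transitivity ((d^T *m X *m u) 0 0).
      by rewrite -mulmxA [RHS]mxE; apply: eq_bigr => i _; rewrite [d^T _ _]mxE.
    rewrite mxE; apply: eq_bigr => i _; congr (_ * _).
    by rewrite -[d^T *m X]trmxK trmx_mul trmxK Xsym mxE.
  have Htd : \sum_i H i (w i 0 + t * e i 0) - \sum_i H i (w i 0) <=
      - (t * \sum_i g i (w i 0 + t * e i 0) * e i 0).
    rewrite mulr_sumr -sumrB -sumrN; apply: ler_sum => i _.
    have -> : - (t * (g i (w i 0 + t * e i 0) * e i 0)) =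
      g i (w i 0 + t * e i 0) * (w i 0 - (w i 0 + t * e i 0)) by ring.
    by apply: (HP i).2; [rewrite -wtd; exact: mP|exact: mP].
  have := umin _ utd; rewrite /Phi quad_formD//.
  under [X in _ <= _ + X]eq_bigr do rewrite wtd.
  have -> : quad_form X (t *: d) = t ^+ 2 * quad_form X d.
    have trZ : (t *: d)^T = t *: d^T by exact: linearZ.
    rewrite /quad_form trZ -!scalemxAl -scalemxAr [LHS]mxE [X in t * X]mxE.
    by rewrite mulrA expr2.
  have -> : \sum_i (t *: d) i 0 * (X *m u) i 0 = t * \sum_i e i 0 * u i 0.
    rewrite -dXu mulr_sumr; apply: eq_bigr => i _.
    by rewrite [(t *: d) _ _]mxE mulrA.
  have phiE : phi t = t / 2 * quad_form X d +
      \sum_i (g i (w i 0) * e i 0) - \sum_i g i (w i 0 + t * e i 0) * e i 0.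
    rewrite -addrA -sumrB; congr (_ + _); apply: eq_bigr => i _; exact: mulrBl.
  have : quad_form X d = \sum_i (g i (w i 0) * e i 0) - \sum_i e i 0 * u i 0.
    rewrite de -sumrB; apply: eq_bigr => i _; rewrite dE; ring.
  rewrite phiE; nra.
have phi_cont : continuous phi.
  have idc : continuous (fun t : R => t) by move=> t; exact: cvg_id.
  have te_cont i : continuous (fun t : R => w i 0 + t * e i 0).
    apply: (addc); first exact: cst_continuous.
    by apply: (mulc); [exact: idc|exact: cst_continuous].
  rewrite /phi; apply: (addc).
    apply: (mulc); last exact: cst_continuous.
    by apply: (mulc); [exact: idc|exact: cst_continuous].
  apply: (sum_cont) => i; apply: (mulc); last exact: cst_continuous.
  apply: (addc); first exact: cst_continuous.
  by move=> t; apply: cvgN; apply: continuous_comp; [exact: te_cont|exact: cg].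
have phi0 : phi 0 = 0.
  by rewrite /phi !mul0r add0r big1// => i _; rewrite mul0r addr0 subrr mul0r.
have phi_cvg : phi t @[t --> 0^'+] --> (0 : R).
  by rewrite -[X in _ --> X]phi0; apply: cvg_at_right_filter; exact: phi_cont.
suff : quad_form X d <= 0 by rewrite leNgt Qd_gt0.
rewrite -(cvg_lim _ phi_cvg)//; apply: limr_ge; first exact: cvgP phi_cvg.
near=> t; apply: slope; apply/andP; split; near: t.
  exact: nbhs_right_gt.
exact: nbhs_right_le.
Unshelve. all: by end_near. Qed.

(** * The generalized inverse and the subgradients of the cost *)

Section ControlCost.
Context (R : realType) (f : R -> R).
Context (f_nonincr : forall v w, v <= w -> f w <= f v) (f0 : f 0 = 0).
Context (f_inj : forall v w, v < w -> f v = f w -> f v = 0).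

Local Notation mu := (@lebesgue_measure R).

Lemma le_gen_inv y w : y != 0 -> y <= f w -> (w%:E <= gen_inv f y)%E.
Proof.
move=> /negbTE y0 yw; rewrite /gen_inv y0; apply: ereal_sup_ubound.
by exists w.
Qed.

(** A [v] beyond [w] with y <= f v would force f w = f v = y, whereas [f] takes a nonzero value at
    most once. *)
Lemma gen_inv_le y w : y != 0 -> f w <= y -> (gen_inv f y <= w%:E)%E.
Proof.
move=> y0 wy; rewrite /gen_inv (negbTE y0); apply: ge_ereal_sup => _ [v /= yv <-].
rewrite lee_fin leNgt; apply/negP => wv.
have fwv : f w = f v.
  by apply/le_anti; rewrite (le_trans wy yv) f_nonincr// ltW.
have fw0 := f_inj wv fwv.
by move: y0; rewrite (_ : y = 0) ?eqxx//; apply/le_anti; rewrite -fw0 wy fw0 -fw0 fwv yv.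
Qed.

Lemma gen_inv_le0 y : 0 <= y -> (gen_inv f y <= 0)%E.
Proof.
rewrite le_eqVlt => /predU1P[<-|y0]; first by rewrite /gen_inv eqxx.
by apply: gen_inv_le; rewrite ?gt_eqF// f0 ltW.
Qed.

Lemma gen_inv_ge0 y : y <= 0 -> (0 <= gen_inv f y)%E.
Proof.
rewrite le_eqVlt => /predU1P[->|y0]; first by rewrite /gen_inv eqxx.
by apply: le_gen_inv; rewrite ?lt_eqF// f0 ltW.
Qed.

(** The set of [v] with y <= f v shrinks as [y] grows. When 0 is one of the arguments or lies
    between them, the signs of the two values decide. *)
Lemma gen_inv_nonincr y z : y <= z -> (gen_inv f z <= gen_inv f y)%E.
Proof.
move=> yz; have [z0|z0] := leP 0 z.
  have [y0|y0] := leP y 0.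
    exact: (le_trans (gen_inv_le0 z0) (gen_inv_ge0 y0)).
  rewrite /gen_inv !gt_eqF//; last exact: lt_le_trans yz.
  by apply: le_ereal_sup => _ [v /= zv <-]; exists v => //=; exact: le_trans zv.
rewrite /gen_inv !lt_eqF//; last exact: le_lt_trans z0.
by apply: le_ereal_sup => _ [v /= zv <-]; exists v => //=; exact: le_trans zv.
Qed.

(** By monotonicity, the preimage of a ray is an interval. *)
Lemma measurable_gen_inv (D : set (measurableTypeR R)) : measurable D -> measurable_fun D (gen_inv f).
Proof.
move=> mD; apply: (measurability _ (ErealGenCInfty.measurableE R)) => //.
move=> _ [_ [x ->] <-]; apply: measurableI => //.
apply: is_interval_measurable => s t /=.
rewrite !in_itv/= !andbT => xs xt u /andP[su ut].
by rewrite in_itv/= andbT; apply: (le_trans xt); exact: gen_inv_nonincr.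
Qed.

(** With the absolute value the integrand is nonnegative, so [J] is additive and monotone even when
    infinite. Between 0 and [q] it is the cost of [q]. *)
Let J a b := (\int[mu]_(y in `[a, b]) `|gen_inv f y|)%E.

Let measurable_abs (D : set (measurableTypeR R)) : measurable D ->
  measurable_fun D (fun y => `|gen_inv f y|%E).
Proof. by move=> mD; apply: measurableT_comp => //; exact: measurable_gen_inv. Qed.

(** Estimates of [J] then concern interior points only, and these are nonzero when the interval lies
    on one side of 0. *)
Let J_open a b : J a b = (\int[mu]_(y in `]a, b[) `|gen_inv f y|)%E.
Proof.
rewrite /J -integral_itv_bndo_bndc; last exact: measurable_abs.
by rewrite integral_itv_obnd_cbnd//; exact: measurable_abs.
Qed.

Let J_cat a b c : a <= b -> b <= c -> J a c = (J a b + J b c)%E.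
Proof.
move=> ab bc.
rewrite /J (@itv_bndbnd_setU _ _ _ (BRight b)) ?bnd_simp//.
rewrite ge0_integral_setU//.
- by rewrite integral_itv_obnd_cbnd//; exact: measurable_abs.
- by apply: measurable_abs; exact: measurableU.
- apply/disj_setPS => y [] /=; rewrite !in_itv/= => /andP[_ yb] /andP[].
  by rewrite ltNge yb.
Qed.

Let J_le a b c : a <= b -> 0 <= c ->
  (forall y, a < y < b -> (`|gen_inv f y| <= c%:E)%E) ->
  (J a b <= (c * (b - a))%:E)%E.
Proof.
move=> ab c0 hc; rewrite J_open EFinM.
have <- := lebesgue_measure_bnd false true ab.
rewrite -integral_cst//; apply: ge0_le_integral => //.
exact: measurable_abs.
Qed.

Let J_ge a b c : a <= b -> 0 <= c ->
  (forall y, a < y < b -> (c%:E <= `|gen_inv f y|)%E) ->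
  ((c * (b - a))%:E <= J a b)%E.
Proof.
move=> ab c0 hc; rewrite J_open EFinM.
have <- := lebesgue_measure_bnd false true ab.
rewrite -integral_cst//; apply: ge0_le_integral => //.
exact: measurable_abs.
Qed.

Let J_ge0 a b : (0 <= J a b)%E.
Proof. by apply: integral_ge0 => y _; exact: abse_ge0. Qed.

Let cost_ge0E q : 0 <= q -> cost f q = J 0 q.
Proof.
move=> q0; rewrite /cost q0.
suff -> : (\int[mu]_(y in `[0%R, q]) gen_inv f y = - J 0%R q)%E by rewrite oppeK.
rewrite /J -integral_ge0N; last by move=> y _; exact: abse_ge0.
apply: eq_integral => y; rewrite inE/= in_itv/= => /andP[y0 _].
by rewrite lee0_abs ?oppeK// gen_inv_le0.
Qed.

Let cost_le0E q : q <= 0 -> cost f q = J q 0.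
Proof.
rewrite le_eqVlt => /predU1P[->|q0]; first exact: cost_ge0E.
rewrite /cost leNgt q0; apply: eq_integral => y.
rewrite inE/= in_itv/= => /andP[_ y0].
by rewrite gee0_abs// gen_inv_ge0.
Qed.

Lemma cost_ge0 q : (0 <= cost f q)%E.
Proof.
by case/orP: (le_total 0 q) => q0; [rewrite cost_ge0E|rewrite cost_le0E].
Qed.

Lemma cost0 : cost f 0 = 0%E.
Proof. by rewrite cost_ge0E// /J set_itv1 integral_set1. Qed.

(** The costs differ by the integral over the interval between [r] and [q], where the hypotheses
    place [gen_inv f] on the right side of [w]: below it if r < q, above it if q < r. *)
Let cost_subgradient_pos r q w : 0 <= r -> 0 <= q ->
  (r < q -> f w <= r) -> (q < r -> r <= f w) ->
  (cost f r + (w * (r - q))%:E <= cost f q)%E.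
Proof.
move=> r0 q0 rq qr; rewrite !cost_ge0E//.
have [lt_rq|lt_qr|->] := ltgtP r q.
- rewrite (J_cat r0 (ltW lt_rq)); apply: leeD2l.
  (* If w >= 0 the added term is nonpositive and J >= 0 suffices; otherwise - w is a nonnegative
     lower bound of the integrand. *)
  have [w0|/ltW w0] := leP 0 w.
    by apply: le_trans (J_ge0 r q); rewrite lee_fin mulr_ge0_le0// subr_le0 ltW.
  have -> : w * (r - q) = - w * (q - r) by ring.
  apply: J_ge => [||y /andP[ry _]]; rewrite ?oppr_ge0 ?(ltW lt_rq)//.
  have y0 : 0 < y := le_lt_trans r0 ry.
  rewrite lee0_abs ?gen_inv_le0 ?(ltW y0)// EFinN leeN2.
  by apply: gen_inv_le; [rewrite gt_eqF|exact: le_trans (rq lt_rq) (ltW ry)].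
- have w0 : w <= 0.
    rewrite leNgt; apply/negP => /ltW /f_nonincr.
    by rewrite f0 leNgt (lt_le_trans (le_lt_trans q0 lt_qr) (qr lt_qr)).
  rewrite (J_cat q0 (ltW lt_qr)) -addeA -[leRHS]adde0; apply: leeD2l.
  rewrite -[w]opprK mulNr EFinN; rewrite leeBlDr// add0e.
  apply: J_le => [||y /andP[qy yr]]; rewrite ?oppr_ge0 ?(ltW lt_qr)//.
  have y0 : 0 < y := le_lt_trans q0 qy.
  rewrite lee0_abs ?gen_inv_le0 ?(ltW y0)// EFinN leeN2.
  by apply: le_gen_inv; [rewrite gt_eqF|exact: le_trans (ltW yr) (qr lt_qr)].
- by rewrite subrr mulr0 adde0.
Qed.

Let cost_subgradient_neg r q w : r <= 0 -> q <= 0 ->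
  (r < q -> f w <= r) -> (q < r -> r <= f w) ->
  (cost f r + (w * (r - q))%:E <= cost f q)%E.
Proof.
move=> r0 q0 rq qr; rewrite !cost_le0E//.
have [lt_rq|lt_qr|->] := ltgtP r q.
- have w0 : 0 <= w.
    rewrite leNgt; apply/negP => /ltW /f_nonincr.
    by rewrite f0 leNgt (le_lt_trans (rq lt_rq) (lt_le_trans lt_rq q0)).
  rewrite (J_cat (ltW lt_rq) q0) addeAC -[leRHS]add0e; apply: leeD2r.
  have -> : w * (r - q) = - (w * (q - r)) by ring.
  rewrite EFinN leeBlDr// add0e.
  apply: J_le => [||y /andP[ry yq]]; rewrite ?(ltW lt_rq)//.
  have y0 : y < 0 := lt_le_trans yq q0.
  rewrite gee0_abs ?gen_inv_ge0 ?(ltW y0)//.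
  by apply: gen_inv_le; [rewrite lt_eqF|exact: le_trans (rq lt_rq) (ltW ry)].
- rewrite (J_cat (ltW lt_qr) r0) [leLHS]addeC; apply: leeD2r.
  have [w0|/ltW w0] := leP w 0.
    by apply: le_trans (J_ge0 q r); rewrite lee_fin mulr_le0_ge0// subr_ge0 ltW.
  apply: J_ge => [||y /andP[_ yr]]; rewrite ?(ltW lt_qr)//.
  have y0 : y < 0 := lt_le_trans yr r0.
  rewrite gee0_abs ?gen_inv_ge0 ?(ltW y0)//.
  by apply: le_gen_inv; [rewrite lt_eqF|exact: le_trans (ltW yr) (qr lt_qr)].
- by rewrite subrr mulr0 adde0.
Qed.

(** When [r] and [q] lie on opposite sides of 0, the sign of [w] allows [q] to be replaced by 0,
    where the cost attains its minimum 0. *)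
Lemma cost_subgradient r q w :
  (r < q -> f w <= r) -> (q < r -> r <= f w) ->
  (cost f r + (w * (r - q))%:E <= cost f q)%E.
Proof.
have [r0|r0] := leP 0 r; have [q0|q0] := leP 0 q.
- exact: cost_subgradient_pos.
- have [r_eq0|rN0] := eqVneq r 0.
    by apply: cost_subgradient_neg; rewrite ?r_eq0// ltW.
  move=> _ /(_ (lt_le_trans q0 r0)) rw.
  have r_gt0 : 0 < r by rewrite lt_def rN0.
  have w0 : w <= 0.
    by rewrite leNgt; apply/negP => /ltW /f_nonincr; rewrite f0 leNgt (lt_le_trans r_gt0 rw).
  apply: le_trans (cost_ge0 q).
  apply: (@le_trans _ _ (cost f r + (w * (r - 0))%:E)%E).
    by rewrite leeD2l// lee_fin ler_wnM2l// lerD2l lerN2 ltW.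
  rewrite -cost0; apply: cost_subgradient_pos => // r_lt0.
  by move: r0; rewrite leNgt r_lt0.
- move=> /(_ (lt_le_trans r0 q0)) wr _.
  have w0 : 0 <= w.
    by rewrite leNgt; apply/negP => /ltW /f_nonincr; rewrite f0 leNgt (le_lt_trans wr r0).
  apply: le_trans (cost_ge0 q).
  apply: (@le_trans _ _ (cost f r + (w * (r - 0))%:E)%E).
    by rewrite leeD2l// lee_fin ler_wpM2l// lerD2l lerN2.
  rewrite -cost0; apply: cost_subgradient_neg => //; first exact: ltW.
  by move=> /ltW; rewrite leNgt r0.
- by apply: cost_subgradient_neg; exact: ltW.
Qed.

End ControlCost.

(** * Projection onto an interval and the feasible sets *)

Definition clamp (R : realType) (lo hi y : R) : R := Num.max lo (Num.min hi y).

Lemma clamp_itv (R : realType) (lo hi y : R) : lo <= hi -> lo <= clamp lo hi y <= hi.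
Proof.
by move=> lohi; rewrite /clamp le_max lexx/= ge_max lohi ge_min lexx.
Qed.

(** If the interval leaves room above the projection, [y] was not cut off at [hi]. This and
    [clamp_lt] supply the two hypotheses of [cost_subgradient]. *)
Lemma clamp_gt (R : realType) (lo hi y z : R) :
  z <= hi -> clamp lo hi y < z -> y <= clamp lo hi y.
Proof.
rewrite /clamp => zhi; rewrite gt_max gt_min => /andP[_ /orP[hiz|yz]].
  by move: zhi; rewrite leNgt hiz.
by rewrite le_max le_min lexx (ltW (lt_le_trans yz zhi)) orbT.
Qed.

Lemma clamp_lt (R : realType) (lo hi y z : R) :
  lo <= z -> z < clamp lo hi y -> clamp lo hi y <= y.
Proof.
rewrite /clamp => loz; rewrite lt_max => /orP[zlo|]; first by move: loz; rewrite leNgt zlo.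
rewrite lt_min => /andP[zhi zy].
by rewrite ge_max ge_min lexx orbT (ltW (le_lt_trans loz zy)).
Qed.

Lemma clamp_nondecr (R : realType) (lo hi y z : R) :
  y <= z -> clamp lo hi y <= clamp lo hi z.
Proof.
move=> yz; rewrite /clamp ge_max !le_max lexx/= le_min !ge_min lexx/= yz.
by rewrite !orbT.
Qed.

Lemma clamp_continuous (R : realType) (f : R -> R) (lo hi : R) :
  continuous f -> continuous (fun v => clamp lo hi (f v)).
Proof.
move=> cf v; rewrite /clamp.
apply: (@continuous_max _ _ (fun=> lo) (fun v => Num.min hi (f v))).
  exact: cst_continuous.
by apply: (@continuous_min _ _ (fun=> hi) f); [exact: cst_continuous|exact: cf].
Qed.

(** The clamped value is strictly closer to [y] than any other point of the interval, so the choice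
    made by [get] can only be this value. *)
Lemma proj_itv (R : realType) (lo hi y : R) : lo <= hi ->
  Defs.proj [set z | lo <= z <= hi] y = clamp lo hi y.
Proof.
move=> lohi; have cb := clamp_itv y lohi; set c := clamp lo hi y in cb *.
have c_lt z : z <= hi -> c < z -> `|y - c| < `|y - z|.
  move=> zhi cz; have yc : y <= c := clamp_gt zhi cz.
  by rewrite !ler0_norm ?subr_le0// ?(le_trans yc (ltW cz))// ltrN2 ltrD2l ltrN2.
have c_gt z : lo <= z -> z < c -> `|y - c| < `|y - z|.
  move=> loz zc; have cy : c <= y := clamp_lt loz zc.
  by rewrite !ger0_norm ?subr_ge0// ?(le_trans (ltW zc) cy)// ltrD2l ltrN2.
have closest w : lo <= w <= hi -> `|y - c| <= `|y - w|.
  move=> /andP[low whi]; have [cw|wc|->//] := ltgtP c w.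
    exact: ltW (c_lt w whi cw).
  exact: ltW (c_gt w low wc).
rewrite /Defs.proj; set P := [set z | _].
have [/andP[loz zhi] /(_ c cb)] : P (get P) by apply: getPex; exists c.
have [zc|cz|//] := ltgtP (get P) c.
  by rewrite leNgt (c_gt _ loz zc).
by rewrite leNgt (c_lt _ zhi cz).
Qed.

(** Treats both kinds of buses as intervals. That 0 is feasible for an inverter later gives
    finiteness of its cost at an equilibrium. *)
Lemma bus_set_itv (R : realType) n (inverter : pred 'I_n)
    (p s rho qfix : 'I_n -> R) i :
  (inverter i -> 0 <= p i <= s i) -> (inverter i -> 0 <= rho i <= pi / 2) ->
  exists lohi : R * R, [/\ lohi.1 <= lohi.2,
    bus_set inverter p s rho qfix i = [set y | lohi.1 <= y <= lohi.2] &
    inverter i -> lohi.1 <= 0 <= lohi.2].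
Proof.
move=> p_range rho_range; rewrite /bus_set; case: ifP => [inv_i|_]; last first.
  exists (qfix i, qfix i); split => //.
  by apply/seteqP; split => y /=; [move->; rewrite lexx|move=> /le_anti].
have /andP[p0 _] := p_range inv_i; have /andP[rho0 rho_le] := rho_range inv_i.
have tan0 : rho i != pi / 2 -> 0 <= p i * tan (rho i).
  move=> rhoN; rewrite mulr_ge0// /tan divr_ge0//.
    apply: sin_ge0_pi; rewrite rho0/= (le_trans rho_le)//.
    by rewrite ler_pdivrMr// ler_peMr ?pi_ge0// ler1n.
  apply: cos_ge0_pihalf; rewrite rho_le andbT (le_trans _ rho0)//.
  by rewrite oppr_le0 divr_ge0// pi_ge0.
suff zero_in : qmin (p i) (s i) (rho i) <= 0 <= qmax (p i) (s i) (rho i).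
  exists (qmin (p i) (s i) (rho i), qmax (p i) (s i) (rho i)); split => //=.
  by have /andP[l r] := zero_in; exact: le_trans l r.
rewrite /qmin /qmax; case: eqP => [_|/eqP /tan0 t0].
  by rewrite oppr_le0 sqrtr_ge0.
by rewrite ge_max oppr_le0 t0 oppr_le0 le_min sqrtr_ge0 t0.
Qed.

(** * Equilibria as unique minimisers *)

Lemma control_inj_off_zero (R : realType) (f : R -> R) (delta : R) :
  (forall v, - (delta / 2) <= v <= delta / 2 -> f v = 0) ->
  (forall v w, v < - (delta / 2) \/ delta / 2 < v ->
     w < - (delta / 2) \/ delta / 2 < w -> v < w -> f w < f v) ->
  forall v w, v < w -> f v = f w -> f v = 0.
Proof.
move=> dead decr v w vw fvw.
have outside z : f z != 0 -> z < - (delta / 2) \/ delta / 2 < z.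
  move=> /eqP fz; apply/orP; rewrite !ltNge -negb_and; apply/negP.
  by move=> /dead.
apply/eqP/negPn/negP => fv0.
have := decr v w (outside v fv0) (outside w _) vw.
by rewrite -fvw ltxx => /(_ fv0).
Qed.

(** The gradient at [q] of the quadratic and linear terms is w = X q + vt - v_nom. Summing the
    subgradient inequalities cancels the first-order terms and leaves the second-order term of the
    quadratic form. *)
Lemma objective_gap (R : realType) n (X : 'M[R]_n) (vt : 'cV[R]_n)
    (f : 'I_n -> R -> R) (q q' : 'cV[R]_n) :
  X^T = X ->
  (forall i, (cost (f i) (q i 0%R) +
      ((voltage X vt q - v_nom R n) i 0 * (q i 0 - q' i 0))%:E
      <= cost (f i) (q' i 0%R))%E) ->
  (objective X vt f q + (2^-1 * quad_form X (q' - q))%:E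
   <= objective X vt f q')%E.
Proof.
move=> Xsym cost_ge; pose d := q' - q.
pose w := voltage X vt q - v_nom R n.
have q'E : q' = q + d by rewrite addrC subrK.
rewrite /objective -addeA.
apply: (@le_trans _ _ (\sum_(i < n) (cost (f i) (q i 0%R) +
    (w i 0 * (q i 0 - q' i 0))%:E) +
    (2^-1 * quad_form X q' + (q'^T *m (vt - v_nom R n)) 0 0)%:E)%E); last first.
  by apply: leeD2r; apply: lee_sum => i _; exact: cost_ge.
rewrite big_split/= -addeA sumEFin -!EFinD; apply: leeD2l; rewrite lee_fin.
have dotE (a b : 'cV[R]_n) : (a^T *m b) 0 0 = \sum_i a i 0 * b i 0.
  by rewrite mxE; apply: eq_bigr => i _; rewrite mxE.
have -> : \sum_i w i 0 * (q i 0 - q' i 0) =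
    - (\sum_i d i 0 * (X *m q) i 0 + (d^T *m (vt - v_nom R n)) 0 0).
  rewrite dotE -big_split/= -sumrN; apply: eq_bigr => i _.
  have -> : w i 0 = (X *m q) i 0 + (vt - v_nom R n) i 0.
    by rewrite /w /voltage -addrA mxE.
  have -> : d i 0 = q' i 0 - q i 0 by rewrite mxE [(- q) _ _]mxE.
  ring.
have -> : q'^T *m (vt - v_nom R n) = q^T *m (vt - v_nom R n) + d^T *m (vt - v_nom R n).
  by rewrite -mulmxDl -raddfD -q'E.
rewrite -/d q'E quad_formD// [X in _ <= _ + (_ + X)]mxE /quad_form -/d.
lra.
Qed.

Unset Implicit Arguments.

Theorem theorem1 (R : realType) (n : nat)
    (L : {set {set 'I_n.+1}}) (x : {set 'I_n.+1} -> R)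
    (L_tree : is_tree L) (x_gt0 : forall l, l \in L -> 0 < x l)
    (vt : 'cV[R]_n)
    (inverter : pred 'I_n) (p s rho qfix : 'I_n -> R)
    (p_range : forall i, inverter i -> 0 <= p i <= s i)
    (rho_range : forall i, inverter i -> 0 <= rho i <= pi / 2)
    (f : 'I_n -> R -> R) (delta : 'I_n -> R)
    (delta_ge0 : forall i, 0 <= delta i)
    (f_deadband : forall i v, - (delta i / 2) <= v <= delta i / 2 -> f i v = 0)
    (f_nonincreasing : forall i v w, v <= w -> f i w <= f i v)
    (f_decreasing : forall i v w,
       v < - (delta i / 2) \/ delta i / 2 < v ->
       w < - (delta i / 2) \/ delta i / 2 < w ->
       v < w -> f i w < f i v)
    (f_derivable : forall i v,
       v < - (delta i / 2) \/ delta i / 2 < v -> derivable (f i) v 1)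
    (f_continuous : forall i, continuous (f i))
    (cost_qfix : forall i, ~~ inverter i -> (cost (f i) (qfix i) < +oo)%E) :
  let X := reactance_matrix L x in
  let Omega := bus_set inverter p s rho qfix in
  let F := objective X vt f in
  (exists! vq : 'cV[R]_n * 'cV[R]_n, equilibrium X vt Omega f vq.1 vq.2) /\
  (forall v q : 'cV[R]_n,
     equilibrium X vt Omega f v q <->
     unique (minimizer (box Omega) F) q /\ v = X *m q + vt).
Proof.
move=> X Omega F.
have Xsym : X^T = X := reactance_matrix_sym L x.
have Xpos u : u != 0 -> 0 < quad_form X u by exact: reactance_matrix_posdef.
have f0 i : f i 0 = 0.
  by apply: f_deadband; rewrite oppr_le0 andbb divr_ge0.
have f_inj i := control_inj_off_zero (f_deadband i) (f_decreasing i).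
have /choice[lohi lohiP] : forall i, exists lohi : R * R, [/\ lohi.1 <= lohi.2,
    Omega i = [set y | lohi.1 <= y <= lohi.2] &
    inverter i -> lohi.1 <= 0 <= lohi.2].
  by move=> i; apply: bus_set_itv; [exact: p_range|exact: rho_range].
pose lo i := (lohi i).1; pose hi i := (lohi i).2.
have lo_hi i : lo i <= hi i by case: (lohiP i).
have OmegaE i : Omega i = [set y | lo i <= y <= hi i] by case: (lohiP i).
have injectionE v : injection Omega f v =
    \col_i clamp (lo i) (hi i) (f i ((v - v_nom R n) i 0)).
  by apply/matrixP => i j; rewrite !mxE OmegaE proj_itv// ord1 mxE.
have [q0 q0E] : exists q0, q0 = injection Omega f (voltage X vt q0).
  have [|||q0 q0E] := @monotone_fixed_point R n X (vt - v_nom R n)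
    (fun i y => clamp (lo i) (hi i) (f i y)) lo hi Xsym Xpos.
  - by move=> i; exact: clamp_continuous.
  - by move=> i v w vw; exact/clamp_nondecr/f_nonincreasing.
  - by move=> i v; exact: clamp_itv.
  exists q0; rewrite injectionE /voltage [LHS]q0E.
  by apply/matrixP => i j; rewrite !mxE addrA.
have equilibrium_minimizer q : q = injection Omega f (voltage X vt q) ->
    unique (minimizer (box Omega) F) q.
  move=> qE; pose w := voltage X vt q - v_nom R n.
  have qiE i : q i 0 = clamp (lo i) (hi i) (f i (w i 0)).
    by rewrite [in LHS]qE injectionE mxE.
  have q_box : box Omega q.
    by move=> i; rewrite OmegaE/= qiE clamp_itv.
  have subgrad i r : lo i <= r <= hi i ->
      (cost (f i) (q i 0%R) + (w i 0 * (q i 0 - r))%:E <= cost (f i) r)%E.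
    move=> /andP[lor rhi]; apply: cost_subgradient => //.
    - exact: f_nonincreasing.
    - exact: f_inj.
    - by rewrite qiE; exact: clamp_gt.
    - by rewrite qiE; exact: clamp_lt.
  have gap q' : box Omega q' ->
      (F q + (2^-1 * quad_form X (q' - q))%:E <= F q')%E.
    move=> q'_box; apply: objective_gap => // i; apply: subgrad.
    by have := q'_box i; rewrite OmegaE.
  have cost_fin i : cost (f i) (q i 0) \is a fin_num.
    rewrite ge0_fin_numE; last exact: (cost_ge0 (f_nonincreasing i) (f0 i) (f_inj i)).
    (* For an inverter, the subgradient inequality against the feasible point 0, of cost 0, excludes
       an infinite cost. At the other buses finiteness is [cost_qfix]. *)
    have [inv_i|fix_i] := boolP (inverter i).
      have zero_in : lo i <= 0 <= hi i by case: (lohiP i) => _ _; exact.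
      have := subgrad i 0 zero_in; rewrite (cost0 (f_nonincreasing i) (f0 i) (f_inj i)).
      by case: (cost (f i) (q i 0)) => [r _|//|_]; rewrite ?ltry ?ltNyr.
    have -> : q i 0 = qfix i; last exact: cost_qfix.
    by have := q_box i; rewrite /Omega /bus_set (negbTE fix_i).
  have F_fin : F q \is a fin_num.
    by rewrite /F /objective fin_numD /= andbT; apply/sum_fin_numP => i _ _; exact: cost_fin.
  have q_min : minimizer (box Omega) F q.
    split=> // q' /gap; apply: le_trans; rewrite leeDl// lee_fin mulr_ge0//.
    have [->|/Xpos/ltW//] := eqVneq (q' - q) 0.
    by rewrite /quad_form mulmx0 mxE.
  split=> // q' [q'_box q'_min]; apply/eqP; rewrite eq_sym -subr_eq0.
  apply/negPn/negP => /Xpos Qpos.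
  (* A second minimiser would give F q + 1/2 (q' - q)' X (q' - q) <= F q; as [F q] is finite it
     cancels, against positive definiteness. *)
  have := le_trans (gap q' q'_box) (q'_min q q_box).
  by rewrite -[leRHS]adde0 leeD2lE// lee_fin leNgt mulr_gt0.
have equilibriumP v q : equilibrium X vt Omega f v q <->
    unique (minimizer (box Omega) F) q /\ v = X *m q + vt.
  split=> [[vE qE]|[[q_min q_uniq] vE]].
    by split=> //; apply: equilibrium_minimizer; rewrite -vE.
  (* For the converse, the equilibrium [q0] is itself a minimiser, hence equals the unique minimiser
     [q]. *)
  have [q0_min _] := equilibrium_minimizer q0 q0E.
  by rewrite vE (q_uniq q0 q0_min).
split=> //; exists (voltage X vt q0, q0); split=> [//|[v q] /= vq].
have [_ q0_uniq] := equilibrium_minimizer q0 q0E.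
have [[q_min _] ->] := (equilibriumP v q).1 vq.
by rewrite (q0_uniq q q_min).
Qed.
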